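(* Let $A$ be a positive information algebra, let $L$ be a join-semilattice disjoint from $A$, and let $S=A\uplus_{\mathrm{ord}}L$ be the overflow semiring. Then \[ \operatorname{sml}(S)=\operatorname{sml}(A)\cup L, \] where $\operatorname{sml}(R)$ denotes the set of small elements of a semiring $R$.
   Context: All semirings are commutative: $(S,+,0)$ and $(S,\cdot,1)$ are commutative monoids, $1\neq 0$, multiplication distributes over addition, and $0$ is absorbing. A semiring is zerosumfree if $a+b=0$ implies $a=b=0$, and entire if $ab=0$ implies $a=0$ or $b=0$; an information algebra is a zerosumfree entire semiring. A positive information algebra is an information algebra with a partial order $\leq$ compatible with $+$ and $\cdot$ (i.e. $x\leq y$ implies $x+z\leq y+z$ and $xz\leq yz$) and having $0$ as least element. $U(R)$ denotes the group of multiplicatively invertible elements of a semiring $R$. An element $a\in R$ is small if $b\in R\setminus U(R)$ implies $a+b\in R\setminus U(R)$. Overflow semiring $S=A\uplus_{\mathrm{ord}}L$: for a positive information algebra $A$ and a join-semilattice $L$ disjoint from $A$, $S=A\cup L$ with the order extending those of $A$ and $L$ by $a\leq\ell$ for all $a\in A,\ell\in L$ (and never $\ell\leq a$), and operations: $x+y=x+_Ay$ if $x,y\in A$, $x+y=\sup\{x,y\}$ otherwise; $xy=x\cdot_Ay$ if $x,y\in A\setminus\{0\}$, $xy=0$ if $x=0$ or $y=0$, and $xy=\sup\{x,y\}$ otherwise. With these, $S$ is a positive information algebra. *)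

(* Defs.v *)
From HB Require Import structures.
From mathcomp Require Import all_boot all_order ssralg.
From mathcomp Require Import classical_sets.

Set Implicit Arguments.
Unset Strict Implicit.
Unset Printing Implicit Defensive.

Import Order.TTheory GRing.Theory.

Local Open Scope ring_scope.
Local Open Scope classical_set_scope.

(* Semirings are commutative with 1 != 0, i.e. comNzSemiRingType. *)

Definition invertibles (R : comNzSemiRingType) : set R :=
  [set a | exists b : R, a * b = 1].

Definition sml (R : comNzSemiRingType) : set R :=
  [set a | forall b : R, (~` @invertibles R) b -> (~` @invertibles R) (a + b)].

Arguments invertibles : clear implicits.
Arguments sml : clear implicits.

HB.mixin Record isInformationAlgebra R of GRing.ComNzSemiRing R := {
  zerosumfree : forall a b : R, a + b = 0 -> a = 0 /\ b = 0;
  entire : forall a b : R, a * b = 0 -> a = 0 \/ b = 0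
}.

#[short(type="infoAlgType")]
HB.structure Definition InformationAlgebra :=
  {R of isInformationAlgebra R & GRing.ComNzSemiRing R}.

HB.mixin Record isPositiveInformationAlgebra (d : Order.disp_t) R
    of InformationAlgebra R & Order.POrder d R := {
  pia_leD2r : forall x y z : R, (x <= y)%O -> (x + z <= y + z)%O;
  pia_leM2r : forall x y z : R, (x <= y)%O -> (x * z <= y * z)%O;
  pia_le0x : forall x : R, ((0 : R) <= x)%O
}.

#[short(type="posInfoAlgType")]
HB.structure Definition PositiveInformationAlgebra (d : Order.disp_t) :=
  {R of isPositiveInformationAlgebra d R & InformationAlgebra R
      & Order.POrder d R}.

(* The carrier is the disjoint union A + L; the alias keeps the structures
   declared below off the bare sum type. *)
Definition overflow (d d' : Order.disp_t) (A : posInfoAlgType d)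
  (L : joinSemilatticeType d') : Type := (A + L)%type.

Fact overflow_display (d d' : Order.disp_t) : Order.disp_t.
Proof. exact: Order.Disp tt tt. Qed.

Section Overflow.
Context {d d' : Order.disp_t} {A : posInfoAlgType d}
  {L : joinSemilatticeType d'}.
Local Notation S := (overflow A L).
Implicit Types x y z : S.

HB.instance Definition _ := Choice.on S.

Definition inA (a : A) : S := inl a.
Definition inL (l : L) : S := inr l.

Definition overflow_le : rel S := fun x y =>
  match x, y with
  | inl a, inl b => (a <= b)%O
  | inl _, inr _ => true
  | inr _, inl _ => false
  | inr l, inr m => (l <= m)%O
  end.

Fact overflow_le_refl : reflexive overflow_le.
Proof. by case=> x /=. Qed.

Fact overflow_le_anti : antisymmetric overflow_le.
Proof. by case=> x [] y //= /le_anti ->. Qed.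

Fact overflow_le_trans : transitive overflow_le.
Proof. by case=> y [] x [] z //=; apply: le_trans. Qed.

HB.instance Definition _ := Order.Le_isPOrder.Build (overflow_display d d') S
  overflow_le_refl overflow_le_anti overflow_le_trans.

(* When x and y do not both lie in A, sup {x, y} is the larger of the two if one
   of them is in A, and their join in L otherwise; see overflow_add_sup and
   overflow_mul_sup. *)
Definition overflow_add x y : S :=
  match x, y with
  | inl a, inl b => inA (a + b)
  | inl _, inr m => inL m
  | inr l, inl _ => inL l
  | inr l, inr m => inL (Order.join l m)
  end.

Definition overflow_mul x y : S :=
  match x, y with
  | inl a, inl b => inA (a * b)
  | inl a, inr m => if a == 0 then inA 0 else inL m
  | inr l, inl b => if b == 0 then inA 0 else inL l
  | inr l, inr m => inL (Order.join l m)
  end.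

Fact overflow_addA : associative overflow_add.
Proof. by case=> x [] y [] z //=; rewrite ?addrA ?joinA. Qed.

Fact overflow_addC : commutative overflow_add.
Proof. by case=> x [] y //=; rewrite 1?addrC 1?joinC. Qed.

Fact overflow_add0 : left_id (inA 0) overflow_add.
Proof. by case=> x //=; rewrite add0r. Qed.

HB.instance Definition _ := GRing.isNmodule.Build S
  overflow_addA overflow_addC overflow_add0.

Let mulA_eq0 (a b : A) : (a * b == 0) = (a == 0) || (b == 0).
Proof.
apply/eqP/orP => [/entire[] ->|[] /eqP ->]; rewrite ?eqxx ?mul0r ?mulr0 //.
  by left.
by right.
Qed.

Let addA_eq0 (a b : A) : (a + b == 0) = (a == 0) && (b == 0).
Proof.
apply/eqP/andP => [/zerosumfree[-> ->]|[/eqP -> /eqP ->]]; first by [].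
by rewrite addr0.
Qed.

Fact overflow_mulA : associative overflow_mul.
Proof.
case=> x [] y [] z /=; rewrite ?mulrA ?joinA //.
- rewrite mulA_eq0; case: (y == 0); last by rewrite orbF.
  by rewrite orbT /= mulr0.
- by case: (x =P 0) => [->|/eqP/negPf x0]; case: (z =P 0) => [->|/eqP/negPf z0];
    rewrite /= ?mul0r ?mulr0 ?eqxx ?x0 ?z0.
- by case: (x == 0); rewrite /= ?eqxx.
- by rewrite mulA_eq0; case: (y == 0) => //=; rewrite mul0r.
- by case: (y == 0); rewrite /= ?eqxx.
- by case: (z == 0); rewrite /= ?eqxx.
Qed.

Fact overflow_mulC : commutative overflow_mul.
Proof. by case=> x [] y //=; rewrite 1?mulrC 1?joinC. Qed.

Fact overflow_mul1 : left_id (inA 1) overflow_mul.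
Proof. by case=> x //=; rewrite ?mul1r // oner_eq0. Qed.

Fact overflow_mulDl : left_distributive overflow_mul overflow_add.
Proof.
case=> x [] y [] z /=; rewrite ?mulrDl ?addA_eq0 //.
- by case: (x == 0); case: (y == 0); rewrite /= ?addr0 ?joinxx.
- by case: (z =P 0) => [->|_]; rewrite /= ?mulr0 ?addr0.
- by case: (x == 0); rewrite //= joinCA joinxx.
- by case: (z =P 0) => [->|_]; rewrite /= ?mulr0 ?addr0.
- by case: (y == 0); rewrite //= -joinA joinxx.
- by case: (z == 0); rewrite /= ?addr0.
- by rewrite joinACA joinxx.
Qed.

Fact overflow_mul0 : left_zero (inA 0) overflow_mul.
Proof. by case=> x //=; rewrite ?mul0r ?eqxx. Qed.

Fact overflow_1neq0 : inA 1 != 0 :> S.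
Proof. by apply/eqP => -[] /eqP; rewrite oner_eq0. Qed.

HB.instance Definition _ := GRing.Nmodule_isComNzSemiRing.Build S
  overflow_mulA overflow_mulC overflow_mul1 overflow_mulDl overflow_mul0
  overflow_1neq0.

Fact overflow_zerosumfree x y : x + y = 0 -> x = 0 /\ y = 0.
Proof.
by case: x => x; case: y => y //= -[] /zerosumfree[-> ->].
Qed.

Fact overflow_entire x y : x * y = 0 -> x = 0 \/ y = 0.
Proof.
case: x => x; case: y => y; rewrite /GRing.mul //=.
- by case=> /entire[->|->]; [left|right].
- by case: eqP => [->|//]; left.
- by case: eqP => [->|//]; right.
Qed.

HB.instance Definition _ := isInformationAlgebra.Build S
  overflow_zerosumfree overflow_entire.

Fact overflow_leD2r x y z : (x <= y)%O -> (x + z <= y + z)%O.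
Proof.
case: x => x; case: y => y; case: z => z //=; rewrite /Order.le /GRing.add //=.
- exact: pia_leD2r.
- by move=> _; apply: leUr.
- by move=> h; apply: leU2.
Qed.

Fact overflow_leM2r x y z : (x <= y)%O -> (x * z <= y * z)%O.
Proof.
suff le_mul : overflow_le x y ->
  overflow_le (overflow_mul x z) (overflow_mul y z) by [].
case: x => x; case: y => y; case: z => z //=.
- exact: pia_leM2r.
- case: (x =P 0) => [_ _|x0 xy].
    by case: (y == 0) => /=.
  case: (y =P 0) => [y0|_] //=.
  by case: x0; apply: le_anti; rewrite -{1}y0 xy pia_le0x.
- by move=> _; case: (z =P 0) => [->|_] //=; rewrite mulr0.
- by move=> _; case: (x == 0) => /=; last exact: leUr.
- by case: (z == 0) => /=.
- by move=> xy; apply: leU2.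
Qed.

Fact overflow_le0x x : ((0 : S) <= x)%O.
Proof. by case: x => x //; apply: pia_le0x. Qed.

HB.instance Definition _ :=
  isPositiveInformationAlgebra.Build (overflow_display d d') S
    overflow_leD2r overflow_leM2r overflow_le0x.

Lemma overflow_add_inA (a b : A) : inA a + inA b = inA (a + b).
Proof. by []. Qed.

Lemma overflow_mul_inA (a b : A) : inA a * inA b = inA (a * b).
Proof. by []. Qed.

Lemma overflow_add_sup x y :
  ~ (range inA x /\ range inA y) -> supremums [set x; y] (x + y).
Proof.
have leE u v : (u <= v)%O = overflow_le u v by [].
have addE u v : u + v = overflow_add u v by [].
move=> nA; rewrite addE; split=> [t|t ub].
  case: x y nA => x [] y nA [] ->; rewrite leE //=; last 2 first.
  - exact: leUl.
  - exact: leUr.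
  - by case: nA; split; [exists x | exists y].
  - by case: nA; split; [exists x | exists y].
have xt : (x <= t)%O by apply: ub; left.
have yt : (y <= t)%O by apply: ub; right.
move: xt yt; rewrite !leE; case: x y nA {ub} => x [] y nA //=.
  by case: nA; split; [exists x | exists y].
by case: t => t //= xt yt; rewrite leUx xt yt.
Qed.

Lemma overflow_mul_sup x y : x != 0 -> y != 0 ->
  ~ (range inA x /\ range inA y) -> supremums [set x; y] (x * y).
Proof.
move=> x0 y0 nA; suff -> : x * y = x + y by exact: overflow_add_sup.
case: x y x0 y0 nA => x [] y x0 y0 nA //.
- by case: nA; split; [exists x | exists y].
- by rewrite /GRing.mul /=; case: (x =P 0) => // xE; case/eqP: x0; rewrite xE.
- by rewrite /GRing.mul /=; case: (y =P 0) => // yE; case/eqP: y0; rewrite yE.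
Qed.

End Overflow.

Arguments inA {d d' A} L a.
Arguments inL {d d'} A {L} l.

(* Main.v *)
Require Import Defs.
From mathcomp Require Import all_boot all_order ssralg.
From mathcomp Require Import classical_sets.

Local Open Scope classical_set_scope.

Import GRing.Theory.

(** The units of the overflow semiring are exactly those of [A] ([invertibles_inA],
    [not_invertibles_inL]). A sum with a summand in [L] lies in [L], hence is never a unit: so all
    of [L] is small, and smallness of an element of [A] is tested only by summands from [A]. *)

Lemma invertibles_inA (d d' : Order.disp_t) (A : posInfoAlgType d)
    (L : joinSemilatticeType d') (a : A) :
  invertibles (overflow A L) (inA L a) <-> invertibles A a.
Proof.
split=> [[[b|m]]|[b ab1]].
- by case=> ab1; exists b.
- by rewrite /GRing.mul /=; case: (_ == _) => // -[] /eqP; rewrite eq_sym oner_eq0.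
- by exists (inA L b); rewrite overflow_mul_inA ab1.
Qed.

(** A product with a factor in [L] is [0] or lies in [L], so it is never [1]. *)
Lemma not_invertibles_inL (d d' : Order.disp_t) (A : posInfoAlgType d)
    (L : joinSemilatticeType d') (l : L) :
  ~ invertibles (overflow A L) (inL A l).
Proof.
by case=> -[b|m] //; rewrite /GRing.mul /=; case: (_ == _) => // -[] /eqP;
  rewrite eq_sym oner_eq0.
Qed.

Theorem theorem3p7 (d d' : Order.disp_t) (A : posInfoAlgType d)
    (L : joinSemilatticeType d') :
  sml (overflow A L) = (inA L @` sml A) `|` range (inL A).
Proof.
apply/seteqP; split=> [[a|l] small_x|x [[a small_a <-]|[l _ <-]]].
- left; exists a => // b nb /(invertibles_inA _ _ _ L).
  by rewrite -overflow_add_inA; apply: small_x => /invertibles_inA.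
- by right; exists l.
(* For a summand [m] from [L], the sum [inA L a + m] computes to [m] itself. *)
- case=> [b nb|m _]; last exact: not_invertibles_inL.
  move=> /invertibles_inA; apply: small_a => /(invertibles_inA _ _ _ L).
  exact: nb.
- by case=> [b|m] _; apply: not_invertibles_inL.
Qed.
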